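(* Let $(X(t):t\geqslant 0)$ be a martingale in $\mathcal{A}$, and let $f\colon[0,\infty)\to\mathcal{A}$ be a norm-continuous adapted process. Then for each $t>0$ there exists a Riemann–Stieltjes type integral $\int_0^t f\,dX$, which is a densely defined operator on $\mathcal{H}$ with domain $\mathcal{A}'\varOmega$, affiliated with $\mathcal{A}$. Moreover, this integral is given as the limit $$\lim_{\|\theta\|\to 0}\sum_{k=1}^m f(t_{k-1})\,[X(t_k)-X(t_{k-1})]$$ on $\mathcal{A}'\varOmega$; that is, for every $x'\in\mathcal{A}'$, $$\Big(\int_0^t f\,dX\Big)(x'\varOmega)=\lim_{\|\theta\|\to0}\sum_{k=1}^m f(t_{k-1})\,[X(t_k)-X(t_{k-1})]\,x'\varOmega ,$$ the limit existing in the norm of $\mathcal{H}$ as the mesh $\|\theta\|$ of the partition $\theta=\{0=t_0<t_1<\dots<t_m=t\}$ of $[0,t]$ tends to $0$.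
   Context: Setting. $\mathcal{A}$ is a von Neumann algebra acting in a Hilbert space $\mathcal{H}$, with commutant $\mathcal{A}'$. $\omega$ is a normal faithful state on $\mathcal{A}$ given by a unit vector $\varOmega\in\mathcal{H}$ that is cyclic and separating for $\mathcal{A}$: $\omega(x)=\langle x\varOmega,\varOmega\rangle$. (Hence $\varOmega$ is also cyclic and separating for $\mathcal{A}'$.) A filtration is given: an increasing family $\{\mathcal{A}_t:t\in[0,+\infty)\}$ of von Neumann subalgebras of $\mathcal{A}$ ($\mathcal{A}_s\subset\mathcal{A}_t$ for $s\leqslant t$), together with a family $\{\mathbb{E}_t\}$ of normal conditional expectations $\mathbb{E}_t$ from $\mathcal{A}$ onto $\mathcal{A}_t$ leaving $\omega$ invariant ($\omega\circ\mathbb{E}_t=\omega$). Processes. A process in $\mathcal{A}$ is a function from $[0,+\infty)$ to $\mathcal{A}$. It is adapted if its value at each $t\geqslant0$ belongs to $\mathcal{A}_t$; it is norm-continuous if it is continuous for the operator norm on $\mathcal{A}$. A process $X$ in $\mathcal{A}$ is a martingale if $\mathbb{E}_sX(t)=X(s)$ for all $0\leqslant s\leqslant t$ (so a martingale is adapted). Mesh and limit. The mesh of $\theta=\{0=t_0<t_1<\dots<t_m=t\}$ is $\|\theta\|=\max_k(t_k-t_{k-1})$. A limit $\lim_{\|\theta\|\to0}S_\theta=\eta$ of vectors means: for every $\varepsilon>0$ there is $\delta>0$ such that $\|S_\theta-\eta\|_{\mathcal{H}}<\varepsilon$ for every partition $\theta$ of $[0,t]$ with $\|\theta\|<\delta$.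 Affiliation. An operator $T$ with domain $\mathcal{A}'\varOmega$ is affiliated with $\mathcal{A}$ if for every $y'\in\mathcal{A}'$ and every $\xi\in\mathcal{A}'\varOmega$ one has $y'\xi\in\mathcal{A}'\varOmega$ and $T y'\xi=y'T\xi$ (closedness of $T$ is not required). *)

(* Defs.v *)
From HB Require Import structures.
From mathcomp Require Import all_boot all_order all_algebra.
From mathcomp Require Import complex.
From mathcomp Require Import all_classical all_reals all_analysis.

Set Implicit Arguments.
Unset Strict Implicit.
Unset Printing Implicit Defensive.

Import Order.TTheory GRing.Theory Num.Theory.
Import numFieldNormedType.Exports.

Local Open Scope classical_set_scope.
Local Open Scope ring_scope.
Local Open Scope complex_scope.

(* [hdot] is linear in its first argument and conjugate-linear in the second. *)
HB.mixin Record CompleteNormedModule_isHilbert (R : realType) H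
    of CompleteNormedModule R[i] H := {
  hdot : {dot H for Num.conj} ;
  hdot_norm : forall u : H, hdot u u = `|u| ^+ 2
}.

#[short(type="hilbertType")]
HB.structure Definition Hilbert (R : realType) :=
  { H of CompleteNormedModule R[i] H & CompleteNormedModule_isHilbert R H }.

Section BoundedOperators.
Context {R : realType} {H : hilbertType R}.

(* Everywhere defined operators are plain functions, with the pointwise linear
   structure of [H -> H] and [\o] as product; sets of them are always required
   to consist of bounded ones. *)
Definition bounded_op (x : H -> H) : Prop := linear x /\ continuous x.

(* Meant for bounded operators: on others the supremum may be junk. *)
Definition opnorm (x : H -> H) : R :=
  sup [set complex.Re `|x u| | u in [set u : H | `|u| <= 1]].

Definition is_adjoint (x y : H -> H) : Prop :=
  forall u v : H, hdot (x u) v = hdot u (y v).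

(* In the partial order of R[i], [0 <= z] also says that z is real. *)
Definition positive_op (x : H -> H) : Prop := forall u : H, 0 <= hdot (x u) u.

Definition op_le (x y : H -> H) : Prop := positive_op (y - x).

Definition commutant (M : set (H -> H)) : set (H -> H) :=
  [set y | bounded_op y /\ forall x, M x -> x \o y = y \o x].

Record von_neumann_algebra (M : set (H -> H)) : Prop := {
  vna_bounded : forall x, M x -> bounded_op x ;
  vna_id : M id ;
  vna_add : forall x y, M x -> M y -> M (x + y) ;
  vna_scale : forall (a : R[i]) x, M x -> M (a *: x) ;
  vna_comp : forall x y, M x -> M y -> M (x \o y) ;
  vna_adjoint : forall x, M x -> exists2 y, M y & is_adjoint x y ;
  vna_bicommutant : commutant (commutant M) = M
}.

Definition orbit_of (M : set (H -> H)) (u : H) : set H := [set x u | x in M].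

Definition cyclic_for (M : set (H -> H)) (u : H) : Prop := dense (orbit_of M u).

Definition separating_for (M : set (H -> H)) (u : H) : Prop :=
  forall x, M x -> x u = 0 -> x = 0.

Definition vector_state (u : H) (x : H -> H) : R[i] := hdot (x u) u.

Definition op_directed (D : set (H -> H)) : Prop :=
  D !=set0 /\
  forall x y, D x -> D y -> exists z, [/\ D z, op_le x z & op_le y z].

(* x is the least upper bound of D in the self-adjoint part of M *)
Definition op_sup (M D : set (H -> H)) (x : H -> H) : Prop :=
  [/\ M x, is_adjoint x x, forall y, D y -> op_le y x &
      forall z, M z -> is_adjoint z z -> (forall y, D y -> op_le y z) ->
        op_le x z].

(* Normality as preservation of suprema of bounded increasing nets. *)
Definition normal_map (M N : set (H -> H)) (E : (H -> H) -> (H -> H)) : Prop :=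
  forall (D : set (H -> H)) (x : H -> H),
    (forall y, D y -> M y /\ is_adjoint y y) -> op_directed D ->
    op_sup M D x -> op_sup N (E @` D) (E x).

(* Conditional expectations of M onto N in Umegaki's sense: positive linear
   N-bimodule projections.  E is constrained on M only. *)
Record conditional_expectation (M N : set (H -> H))
    (E : (H -> H) -> (H -> H)) : Prop := {
  ce_range : forall x, M x -> N (E x) ;
  ce_linear : forall (a : R[i]) x y, M x -> M y ->
    E (a *: x + y) = a *: E x + E y ;
  ce_proj : forall x, N x -> E x = x ;
  ce_positive : forall x, M x -> positive_op x -> positive_op (E x) ;
  ce_bimodule : forall a x b, N a -> M x -> N b ->
    E (a \o x \o b) = a \o E x \o b
}.

(* Functions on [0, +oo[ are functions on R, constrained at t >= 0 only. *)
Record filtration (M : set (H -> H)) (omega : (H -> H) -> R[i])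
    (Mt : R -> set (H -> H)) (Et : R -> (H -> H) -> (H -> H)) : Prop := {
  filt_vna : forall t, 0 <= t -> von_neumann_algebra (Mt t) ;
  filt_sub : forall t, 0 <= t -> Mt t `<=` M ;
  filt_mono : forall s t, 0 <= s -> s <= t -> Mt s `<=` Mt t ;
  filt_ce : forall t, 0 <= t -> conditional_expectation M (Mt t) (Et t) ;
  filt_normal : forall t, 0 <= t -> normal_map M (Mt t) (Et t) ;
  filt_inv : forall t, 0 <= t -> forall x, M x -> omega (Et t x) = omega x
}.

Definition process (M : set (H -> H)) (X : R -> H -> H) : Prop :=
  forall t, 0 <= t -> M (X t).

Definition adapted (Mt : R -> set (H -> H)) (X : R -> H -> H) : Prop :=
  forall t, 0 <= t -> Mt t (X t).

Definition opnorm_continuous (X : R -> H -> H) : Prop :=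
  forall s, 0 <= s ->
    opnorm (X r - X s) @[r --> within `[0, +oo[ (nbhs s)] --> (0 : R).

Definition martingale (M : set (H -> H)) (Et : R -> (H -> H) -> (H -> H))
    (X : R -> H -> H) : Prop :=
  process M X /\ forall s t, 0 <= s -> s <= t -> Et s (X t) = X s.

End BoundedOperators.

(* A possibly unbounded operator; its values off the domain are irrelevant. *)
Record operator (R : realType) (H : hilbertType R) := Operator {
  op_dom : set H ;
  op_fun :> H -> H ;
  op_dom0 : op_dom 0 ;
  op_dom_lin : forall (a : R[i]) u v,
    op_dom u -> op_dom v -> op_dom (a *: u + v) ;
  op_lin : forall (a : R[i]) u v,
    op_dom u -> op_dom v -> op_fun (a *: u + v) = a *: op_fun u + op_fun v
}.

Section Integral.
Context {R : realType} {H : hilbertType R}.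

Definition densely_defined (T : operator H) : Prop := dense (op_dom T).

Definition affiliated (M : set (H -> H)) (T : operator H) : Prop :=
  forall y u, commutant M y -> op_dom T u ->
    op_dom T (y u) /\ T (y u) = y (T u).

(* As for [itv_partition], a partition 0 = t_0 < t_1 < ... < t_m = t is
   represented by the sequence s = [:: t_1; ...; t_m], so that
   t_k = nth t (0 :: s) k and t_(k+1) = nth t s k for k < size s. *)
Definition mesh (t : R) (s : seq R) : R :=
  \big[Num.max/0]_(0 <= k < size s) (nth t s k - nth t (0 :: s) k).

Definition RS_sum (f X : R -> H -> H) (t : R) (s : seq R) : H -> H :=
  \sum_(0 <= k < size s)
    (f (nth t (0 :: s) k) \o (X (nth t s k) - X (nth t (0 :: s) k))).

Definition mesh_limit (t : R) (S : seq R -> H) (eta : H) : Prop :=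
  forall e : R, 0 < e -> exists2 d : R, 0 < d &
    forall s, itv_partition 0 t s -> mesh t s < d -> `|S s - eta| < e%:C.

End Integral.

(* Main.v *)
From HB Require Import structures.
Require Import Defs.
From mathcomp Require Import all_boot all_order all_algebra.
From mathcomp Require Import complex.
From mathcomp Require Import all_classical all_reals all_analysis.
From mathcomp Require Import ring lra.
Import Order.TTheory GRing.Theory Num.Theory.
Import numFieldNormedType.Exports.
Set Implicit Arguments.
Unset Strict Implicit.
Unset Printing Implicit Defensive.
Local Open Scope complex_scope.
Local Open Scope classical_set_scope.
Local Open Scope ring_scope.

(* Every x' in the commutant commutes with the Riemann-Stieltjes sums, so it is
   enough that the vectors S_theta Omega converge; the integral then maps
   x' Omega to x' (lim S_theta Omega).  For two partitions of mesh < d, the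
   difference of the sums is a sum over their common refinement of vectors
   (f(c) - f(c')) dX Omega with |c - c'| < d.  By the martingale property the
   increment over [a, b] is orthogonal to At(a) Omega, so these vectors are
   pairwise orthogonal, and the squared norm of the difference is at most
   e^2 * sum |dX Omega|^2 <= e^2 * |X(t) Omega|^2, where e bounds |f(c) - f(c')|
   by uniform continuity on [0, t].
   The domain is dense because the projection P onto the closure of the orbit
   of Omega under the commutant lies in A and satisfies (P - 1) Omega = 0. *)

(** * Hilbert space geometry: completeness, Cauchy-Schwarz, orthogonal projection *)

Lemma dot_projection_residual (C : numClosedFieldType) (U : lmodType C)
    (form : {dot U for Num.conj}) (u v : U) : v != 0 ->
  form (u - (form u v / form v v) *: v) (u - (form u v / form v v) *: v)
    + `|form u v| ^+ 2 / form v v = form u u.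
Proof.
move=> v0; have vv0 : form v v != 0 by rewrite dnorm_eq0.
have vvE : `|form v v| = form v v by rewrite ger0_norm // dnorm_ge0.
have vvr : (form v v)^* = form v v by rewrite -vvE conj_normC.
rewrite dnormB dnormZ linearZr_LR /= normf_div vvE expr_div_n.
rewrite !(rmorphM, fmorphV) /= !vvr !conjCK !normCK; field.
by rewrite vv0.
Qed.

Section HilbertSpace.
Context {R : realType} {H : hilbertType R}.
Implicit Types (u v w : H) (K : set H).

Lemma gt0_realE (z : R[i]) : 0 < z -> z = (complex.Re z)%:C.
Proof. by move=> z0; rewrite RRe_real // gtr0_real. Qed.

Lemma ge0_realE (z : R[i]) : 0 <= z -> z = (complex.Re z)%:C.
Proof. by move=> z0; rewrite RRe_real // ger0_real. Qed.

Lemma realcD (a b : R) : (a + b)%:C = a%:C + b%:C.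
Proof. exact: (rmorphD (real_complex R)). Qed.

Lemma realcM (a b : R) : (a * b)%:C = a%:C * b%:C.
Proof. exact: (rmorphM (real_complex R)). Qed.

Lemma realcV (a : R) : (a^-1)%:C = a%:C^-1.
Proof. exact: (fmorphV (real_complex R)). Qed.

(** The sets [B e] form a filter base whose image under [phi] is Cauchy, so completeness applies. It
    serves for near-minimizers of a distance and for partitions of small mesh. *)
Lemma cauchy_basis_cvg (T : Type) (B : R -> set T) (phi : T -> H) :
    (forall e, 0 < e -> B e !=set0) ->
    (forall d e, d <= e -> B d `<=` B e) ->
    (forall e, 0 < e -> exists2 d, 0 < d &
      forall x y, B d x -> B d y -> `|phi x - phi y| < e%:C) ->
  exists l, forall e, 0 < e -> exists2 d, 0 < d &
    forall x, B d x -> `|phi x - l| < e%:C.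
Proof.
move=> B0 Bmono Bcauchy.
pose F := filter_from [set d : R | 0 < d] B.
have FF : ProperFilter F.
  apply: filter_from_proper => [|d d0]; last exact: B0.
  apply: filter_from_filter; first by exists 1; exact: ltr01.
  move=> d e d0 e0; exists (Num.min d e); first by rewrite /= lt_min d0.
  by move=> x Bx; split; apply: Bmono Bx; rewrite ge_min lexx ?orbT.
have /cauchy_cvg cv : cauchy (phi @ F).
  apply: cauchy_exP => e e0.
  have [|d d0 Bd] := Bcauchy (complex.Re e); first by rewrite -ltcR -gt0_realE.
  have [x Bx] := B0 _ d0.
  exists (phi x); exists d => // y By.
  by rewrite -ball_normE /= (gt0_realE e0); exact: Bd.
exists (lim (phi @ F)) => e e0.
have eC0 : 0 < e%:C by rewrite ltcR.
have /cvgrPdist_lt /(_ _ eC0) [d d0 Bd] := cv.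
by exists d => // x Bx; rewrite distrC; exact: Bd.
Qed.

Lemma le_eps_eq0 (z c : R[i]) : 0 <= z -> 0 <= c ->
  (forall e : R, 0 < e -> z <= c * e%:C) -> z = 0.
Proof.
move=> z0 c0; move: (z0) (c0); rewrite (ge0_realE z0) (ge0_realE c0).
move: (complex.Re z) (complex.Re c) => a b.
rewrite !ler0c le_eqVlt => /predU1P[<- //|a0 b0 ab].
(* For [e = a / (2 * (b + 1))] one has [b * e < a], a contradiction; the [+ 1] allows [b = 0]. *)
have d0 : 0 < 2 * (b + 1) by lra.
have e0 : 0 < a / (2 * (b + 1)) by rewrite divr_gt0.
by exfalso; have := ab _ e0; rewrite -rmorphM lecR mulrA ler_pdivlMr//; nra.
Qed.

Lemma hdotBl u v w : hdot (u - v) w = hdot u w - hdot v w.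
Proof. exact: linearBl. Qed.

Lemma hdotDl u v w : hdot (u + v) w = hdot u w + hdot v w.
Proof. exact: linearDl. Qed.

Lemma hdotZl (a : R[i]) u v : hdot (a *: u) v = a * hdot u v.
Proof. exact: linearZl_LR. Qed.

Lemma hdotZr (a : R[i]) u v : hdot u (a *: v) = a^* * hdot u v.
Proof. exact: linearZr_LR. Qed.

Lemma hdotC u v : hdot u v = (hdot v u)^*.
Proof. by rewrite hermC expr0 mul1r. Qed.

Lemma hdot_ext u v : (forall w, hdot u w = hdot v w) -> u = v.
Proof.
move=> uv; apply/eqP; rewrite -subr_eq0 -(dnorm_eq0 hdot).
by rewrite hdotBl uv subrr.
Qed.

Lemma pythagoras u v : hdot u v = 0 ->
  `|u + v| ^+ 2 = `|u| ^+ 2 + `|v| ^+ 2.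
Proof. by move=> uv; rewrite -!hdot_norm dnormD uv rmorph0 !addr0. Qed.

Lemma parallelogram u v :
  `|u + v| ^+ 2 + `|u - v| ^+ 2 = 2 * (`|u| ^+ 2 + `|v| ^+ 2).
Proof. by rewrite -!hdot_norm dnormD dnormB /=; ring. Qed.

(** Pythagoras for the component of [u] along [v] and its remainder. *)
Lemma projection_residual u v : v != 0 ->
  `|u - (hdot u v / hdot v v) *: v| ^+ 2 + `|hdot u v| ^+ 2 / `|v| ^+ 2
  = `|u| ^+ 2.
Proof.
by move=> v0; rewrite -!hdot_norm; apply: dot_projection_residual.
Qed.

Lemma cauchy_schwarz u v : `|hdot u v| <= `|u| * `|v|.
Proof.
have [->|v0] := eqVneq v 0; first by rewrite linear0r !normr0 mulr0.
rewrite -(@ler_pXn2r _ 2) ?nnegrE ?mulr_ge0// exprMn.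
rewrite -(projection_residual u v0) mulrDl divfK; last first.
  by rewrite expf_eq0 /= normr_eq0.
by rewrite lerDr mulr_ge0 // exprn_ge0.
Qed.

Definition subspace K := K 0 /\ forall (a : R[i]) u v, K u -> K v -> K (a *: u + v).

Definition eps_closed K := forall u,
  (forall e : R, 0 < e -> exists2 v, K v & `|u - v| < e%:C) -> K u.

(** Points of [K] that nearly minimize the distance to [u] are Cauchy by the parallelogram law, and
    [p] is their limit. Orthogonality comes from perturbing such points along [v]. *)
Lemma orth_projection K u : subspace K -> eps_closed K ->
  exists2 p, K p & forall v, K v -> hdot (u - p) v = 0.
Proof.
move=> [K0 Kl] Kcl.
pose sq v := complex.Re (`|v| ^+ 2).
have sqE v : `|v| ^+ 2 = (sq v)%:C by rewrite -ge0_realE ?exprn_ge0.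
have sq_ge0 v : 0 <= sq v by rewrite -lecR -sqE exprn_ge0.
pose E := [set sq (u - v) | v in K].
have Ehas : has_inf E.
  split; first by exists (sq (u - 0)), 0.
  by exists 0 => _ [v _ <-].
have Einf v : K v -> inf E <= sq (u - v).
  by move=> Kv; apply: ge_inf; [exact: Ehas.2|exists v].
have KB v w : K v -> K w -> K (2^-1 *: (v + w)).
  move=> Kv Kw; have := Kl 2^-1 _ _ (Kl 1 _ _ Kv Kw) K0.
  by rewrite scale1r addr0.
pose B e := [set v | K v /\ sq (u - v) < inf E + e].
have B0 e : 0 < e -> B e !=set0.
  by move=> e0; have [_ [v Kv <-] ve] := inf_adherent e0 Ehas; exists v.
have Bmono d e : d <= e -> B d `<=` B e.
  by move=> de v [Kv vd]; split => //; apply: (lt_le_trans vd); rewrite lerD2l.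
have [p pP] : exists p, forall e, 0 < e -> exists2 d, 0 < d &
    forall x, B d x -> `|x - p| < e%:C.
  apply: (@cauchy_basis_cvg _ B id B0 Bmono) => e e0.
  (* The midpoint of [v] and [w] lies in [K], so its squared distance is at least [inf E]; the
     parallelogram law then leaves [sq (w - v) < e ^+ 2]. *)
  exists (e ^+ 2 / 4); first by rewrite divr_gt0 ?exprn_gt0.
    move=> v w [Kv vd] [Kw wd] /=.
    rewrite -(@ltr_pXn2r _ 2) ?nnegrE//; last by rewrite lecR ltW.
    have par : 4 * sq (u - 2^-1 *: (v + w)) + sq (w - v)
             = 2 * (sq (u - v) + sq (u - w)).
      apply: complexI; rewrite !(rmorphD, rmorphM, rmorph_nat) /= -!sqE.
      rewrite -parallelogram; congr (_ + _); last first.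
        by rewrite opprB [in RHS]addrC addrA subrK.
      have -> : (u - v) + (u - w) = 2%:R *: (u - 2^-1 *: (v + w)).
        rewrite scalerBr scalerA divff ?pnatr_eq0// scale1r scaler_nat mulr2n.
        by rewrite opprD addrACA.
      by rewrite normrZ exprMn normr_nat -natrX.
    have := Einf _ (KB _ _ Kv Kw).
    by rewrite distrC sqE -rmorphXn ltcR; lra.
have Kp : K p.
  apply: Kcl => e /pP [d d0 xd].
  by have [_ [v Kv <-] ve] := inf_adherent d0 Ehas; exists v => //;
    rewrite distrC; exact: xd.
exists p => // v Kv.
have [->|v0] := eqVneq v 0; first by rewrite linear0r.
apply/eqP; rewrite -normr_eq0; apply/eqP.
apply: (@le_eps_eq0 _ (2 * `|v|)) => [//||e e0]; first by rewrite mulr_ge0.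
have [d d0 xd] := pP e e0.
(* [x] is close to [p] and minimizes up to [e ^+ 2]. In [u - p = (u - x) + (x - p)] each term pairs
   with [v] to at most [|v| * e]. *)
have [|x Bx] := B0 (Num.min d (e ^+ 2)); first by rewrite lt_min d0 exprn_gt0.
have /xd /ltW xp : B d x by apply: Bmono Bx; rewrite ge_min lexx.
case: Bx => Kx xe.
have -> : u - p = (u - x) + (x - p) by rewrite addrA subrK.
rewrite hdotDl (le_trans (ler_normD _ _))// -mulrA mulr_natl mulr2n lerD//.
  have eC0 : 0 <= e%:C by rewrite ler0c ltW.
  suff: `|hdot (u - x) v| ^+ 2 <= (`|v| * e%:C) ^+ 2.
    by rewrite ler_pXn2r ?nnegrE ?mulr_ge0.
  rewrite exprMn mulrC.
  rewrite -ler_pdivrMr ?exprn_gt0 ?normr_gt0//.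
  set y := _ / _; have := projection_residual (u - x) v0; rewrite -/y.
  set a := _ / _; rewrite -addrA -opprD.
  (* Moving [x] by the best multiple of [v] stays in [K], so it lowers the squared distance by at
     most [e ^+ 2]; the decrease is exactly [y]. *)
  have Ka : K (x + a *: v) by rewrite addrC; exact: Kl.
  move/(canRL (addKr _)) => ->; rewrite [leLHS]addrC !sqE.
  rewrite lerBlDr -(rmorphXn (real_complex R)) -(rmorphD (real_complex R)) lecR.
  have := Einf _ Ka;
  have : Num.min d (e ^+ 2) <= e ^+ 2 by rewrite ge_min lexx orbT.
  by lra.
by rewrite mulrC (le_trans (cauchy_schwarz _ _))// ler_wpM2r.
Qed.

(** * Bounded operators, Riesz representation and adjoints *)

Lemma linear_sub (x : H -> H) u v : linear x -> x (u - v) = x u - x v.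
Proof. by move=> xl; rewrite addrC -scaleN1r xl scaleN1r addrC. Qed.

Lemma linear_zero (x : H -> H) : linear x -> x 0 = 0.
Proof. by move=> xl; rewrite -(subrr 0) linear_sub ?subrr. Qed.

Lemma linear_add (x : H -> H) u v : linear x -> x (u + v) = x u + x v.
Proof. by move=> xl; rewrite -{1}[u]scale1r xl scale1r. Qed.

Lemma bounded_opP (x : H -> H) :
  bounded_op x <-> linear x /\
    exists2 C : R, 0 <= C & forall u, `|x u| <= C%:C * `|u|.
Proof.
split=> -[xl xb]; split=> //;
  pose g : {linear H -> H} := HB.pack x (GRing.isLinear.Build _ _ _ _ x xl).
  have /linear_boundedP [M [Mr gM]] : bounded_near g (nbhs (0 : H)).
    by apply: continuous_linear_bounded; exact: xb.
  (* [gM] speaks of constants strictly above [M], hence the [+ 1]; the maximum keeps the constant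
     nonnegative. *)
  exists (Num.max 0 (complex.Re M) + 1).
    by rewrite addr_ge0 // le_max lexx.
  move=> u; apply: (gM (Num.max 0 (complex.Re M) + 1)%:C).
  by rewrite -(RRe_real Mr) ltcR ltr_pwDr// le_max lexx orbT.
case: xb => C C0 xC; apply: (@bounded_linear_continuous _ _ _ g).
apply/linear_boundedP; exists C%:C; split; first by apply/complex_realP; exists C.
move=> M CM u; apply: le_trans (xC u) _; apply: ler_wpM2r => //; exact: ltW.
Qed.

Lemma le_opnorm (x : H -> H) u : bounded_op x ->
  `|x u| <= (opnorm x)%:C * `|u|.
Proof.
move=> /bounded_opP [xl [C C0 xC]].
have [->|u0] := eqVneq u 0; first by rewrite linear_zero // normr0 mulr0.
have nu0 : 0 < `|u| by rewrite normr_gt0.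
pose v := `|u|^-1 *: u.
have vu : u = `|u| *: v by rewrite scalerA divff ?scale1r ?gt_eqF.
have v1 : `|v| = 1 by rewrite normrZ ger0_norm ?invr_ge0// mulVf ?gt_eqF.
have xu : x u = `|u| *: x v by rewrite {1}vu -[_ *: _]addr0 xl linear_zero ?addr0.
rewrite xu normrZ normr_id mulrC ler_wpM2r//.
rewrite [leLHS]ge0_realE ?normr_ge0// lecR; apply: ub_le_sup.
  exists C => _ [w /= w1 <-].
  rewrite -lecR -ge0_realE ?normr_ge0// (le_trans (xC w))//.
  by rewrite ler_piMr// ler0c.
by exists v => //=; rewrite v1.
Qed.

(** A nonzero [phi] is represented by a multiple of a vector [z] orthogonal to its kernel:
    [phi u *: z - phi z *: u] lies in the kernel, hence is orthogonal to [z]. *)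
Lemma riesz_representation (phi : H -> R[i]) (C : R) : 0 <= C ->
    (forall a u v, phi (a *: u + v) = a * phi u + phi v) ->
    (forall u, `|phi u| <= C%:C * `|u|) ->
  exists w, forall u, phi u = hdot u w.
Proof.
move=> C0 phil phiC.
have phi0 : phi 0 = 0 by have := phil (-1) 0 0; rewrite scaler0 addr0 mulN1r addNr.
have phiB u v : phi (u - v) = phi u - phi v.
  by rewrite addrC -scaleN1r phil mulN1r addrC.
have [phiz|/existsNP [u0 phiu0]] := pselect (forall u, phi u = 0).
  by exists 0 => u; rewrite linear0r phiz.
have Ksub : subspace [set u | phi u = 0].
  by split=> //= a u v pu pv; rewrite phil pu pv mulr0 addr0.
have Kcl : eps_closed [set u | phi u = 0].
  move=> u uK /=; apply/eqP; rewrite -normr_eq0; apply/eqP.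
  apply: (@le_eps_eq0 _ C%:C) => [//||e /uK [v /= pv uv]]; first by rewrite ler0c.
  rewrite -[phi u]subr0 -pv -phiB (le_trans (phiC _))// ler_wpM2l ?ler0c//.
  exact: ltW.
have [p /= pp pK] := orth_projection u0 Ksub Kcl.
pose z := u0 - p; have phiz0 : phi z != 0 by rewrite phiB pp subr0; apply/eqP.
have z0 : z != 0 by apply: contra_neq phiz0 => ->.
(* The conjugate undoes the conjugate-linearity of [hdot] in its second argument. *)
exists ((phi z / hdot z z)^* *: z) => u.
have zz0 : hdot z z != 0 by rewrite dnorm_eq0.
have : hdot (phi u *: z - phi z *: u) z = 0.
  rewrite hdotC pK ?conjC0 //= phiB -[_ *: z]addr0 -[_ *: u]addr0 !phil phi0.
  by rewrite !addr0 mulrC subrr.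
rewrite hdotBl !hdotZl hdotZr conjCK => /eqP; rewrite subr_eq0 => /eqP e.
by rewrite mulrAC -e mulfK.
Qed.

(** Riesz applied to [hdot (x _) v] gives [y v]. The bound [C] passes to [y] because
    [|y v|^2 = hdot (x (y v)) v]. *)
Lemma adjoint_exists (x : H -> H) : bounded_op x ->
  exists2 y, bounded_op y & is_adjoint x y.
Proof.
move=> /bounded_opP [xl [C C0 xC]].
have CC0 : 0 <= C%:C by rewrite ler0c.
have /choice [y yP] v : exists w, forall u, hdot (x u) v = hdot u w.
  apply: (@riesz_representation _ (C * complex.Re `|v|)).
  - by rewrite mulr_ge0 // -ler0c -ge0_realE ?normr_ge0.
  - by move=> a u w; rewrite xl hdotDl hdotZl.
  - move=> u; rewrite (le_trans (cauchy_schwarz _ _))// rmorphM /=.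
    rewrite -ge0_realE ?normr_ge0//.
    by rewrite mulrAC ler_wpM2r.
exists y; last by move=> u v; exact: yP.
have yl : linear y.
  move=> a u v; apply: hdot_ext => w; rewrite hdotC -yP hdotC conjCK.
  rewrite hdotDl hdotZl [RHS]hdotDl hdotZl.
  by congr (_ * _ + _); rewrite hdotC yP hdotC conjCK.
apply/bounded_opP; split=> //; exists C => // v.
have [->|yv0] := eqVneq (y v) 0; first by rewrite normr0 mulr_ge0.
rewrite -(@ler_pM2r _ `|y v|) ?normr_gt0// -expr2 -hdot_norm -yP.
rewrite -[hdot _ _]ger0_norm ?yP ?dnorm_ge0// -yP.
rewrite (le_trans (cauchy_schwarz _ _))// mulrAC ler_wpM2r//.
Qed.

Lemma bounded_op_comb (a : R[i]) (x y : H -> H) :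
  bounded_op x -> bounded_op y -> bounded_op (a *: x + y).
Proof.
move=> /bounded_opP [xl [C C0 xC]] /bounded_opP [yl [D D0 yD]].
apply/bounded_opP; split.
  move=> b u v; change (a *: x (b *: u + v) + y (b *: u + v) =
    b *: (a *: x u + y u) + (a *: x v + y v)).
  rewrite xl yl !scalerDr !scalerA [a * b]mulrC -!addrA; congr (_ + _).
  by rewrite addrCA.
exists (complex.Re `|a| * C + D).
  by rewrite addr_ge0 // mulr_ge0 // -ler0c -ge0_realE ?normr_ge0.
move=> u; change (`|a *: x u + y u| <= (complex.Re `|a| * C + D)%:C * `|u|).
rewrite realcD realcM -ge0_realE ?normr_ge0// mulrDl.
rewrite (le_trans (ler_normD _ _))// lerD// normrZ -mulrA ler_wpM2l//.
Qed.

Lemma bounded_op_comp (x y : H -> H) :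
  bounded_op x -> bounded_op y -> bounded_op (x \o y).
Proof.
move=> [xl xc] [yl yc]; split; first by move=> a u v /=; rewrite yl xl.
by move=> u; apply: continuous_comp; [exact: yc|exact: xc].
Qed.

(** * Algebra of commutants *)

Lemma commutant_id (M : set (H -> H)) : commutant M id.
Proof. by split=> //; split=> // u; exact: cvg_id. Qed.

Lemma commutant_comp (M : set (H -> H)) x y :
  commutant M x -> commutant M y -> commutant M (x \o y).
Proof.
move=> [xb xM] [yb yM]; split; first exact: bounded_op_comp.
move=> z Mz; apply/funext => u /=.
have /(congr1 (fun h => h (y u))) /= -> := xM _ Mz.
by congr x; have /(congr1 (fun h => h u)) := yM _ Mz.
Qed.

Lemma commutantE (M : set (H -> H)) x y u :
  commutant M y -> M x -> y (x u) = x (y u).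
Proof. by move=> [_ yM] /yM /(congr1 (fun h => h u)) /= ->. Qed.

Lemma commutant_comb (M : set (H -> H)) (a : R[i]) x y :
  (forall z, M z -> bounded_op z) ->
  commutant M x -> commutant M y -> commutant M (a *: x + y).
Proof.
move=> Mb [xb xM] [yb yM]; split; first exact: bounded_op_comb.
move=> z Mz; apply/funext => u.
have zl := (Mb _ Mz).1.
change (z (a *: x u + y u) = a *: x (z u) + y (z u)); rewrite zl.
by rewrite (commutantE _ (conj xb xM) Mz) (commutantE _ (conj yb yM) Mz).
Qed.

Lemma is_adjointC (x y : H -> H) : is_adjoint x y -> is_adjoint y x.
Proof. by move=> xy u v; rewrite hdotC -xy -hdotC. Qed.

(** Taking adjoints in [x z' = z' x], where [z'] is the adjoint of [z], gives [z y = y z]. *)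
Lemma commutant_adjoint (M : set (H -> H)) x :
  (forall z, M z -> exists2 z', M z' & is_adjoint z z') ->
  commutant M x -> exists2 y, commutant M y & is_adjoint x y.
Proof.
move=> Madj xM; have [y yb xy] := adjoint_exists xM.1.
exists y => //; split=> // z /Madj [z' Mz' zz'].
apply/funext => u /=; apply: hdot_ext => w.
by rewrite zz' !(is_adjointC xy) zz' (commutantE _ xM Mz').
Qed.

(** * Norm closures of subspaces, and cyclicity for the commutant *)

Definition eps_closure (S : set H) : set H :=
  [set u | forall e : R, 0 < e -> exists2 v, S v & `|u - v| < e%:C].

Lemma subset_eps_closure S : S `<=` eps_closure S.
Proof. by move=> u Su e e0; exists u => //; rewrite subrr normr0 ltcR. Qed.

Lemma eps_closed_closure S : eps_closed (eps_closure S).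
Proof.
move=> u uS e e0; have e20 : 0 < e / 2 by rewrite divr_gt0.
have [v vS uv] := uS _ e20; have [w Sw vw] := vS _ e20.
exists w => //; rewrite -[u - w](subrKA v) [e]splitr.
by rewrite realcD (le_lt_trans (ler_normD _ _))// ltrD.
Qed.

Lemma eps_closure_bounded_op (S T : set H) (x : H -> H) :
  bounded_op x -> (forall u, S u -> T (x u)) ->
  forall u, eps_closure S u -> eps_closure T (x u).
Proof.
move=> /bounded_opP [xl [C C0 xC]] ST u uS e e0.
have C1 : 0 < C + 1 by rewrite ltr_wpDl.
have [v Sv uv] := uS (e / (C + 1)) (divr_gt0 e0 C1).
exists (x v); first exact: ST.
rewrite -linear_sub//.
apply: (@le_lt_trans _ _ ((C + 1)%:C * `|u - v|)).
  by rewrite (le_trans (xC _))// ler_wpM2r// lecR lerDl.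
by rewrite mulrC -ltr_pdivlMr ?ltcR// -realcV -realcM.
Qed.

Lemma subspace_eps_closure S : subspace S -> subspace (eps_closure S).
Proof.
move=> [S0 Sl]; split; first exact: subset_eps_closure.
move=> a u v uS vS e e0; have e20 : 0 < e / 2 by rewrite divr_gt0.
have ea0 : 0 < e / 2 / (complex.Re `|a| + 1).
  by rewrite divr_gt0// ltr_wpDl// -ler0c -ge0_realE ?normr_ge0.
have [u' Su' uu'] := uS _ ea0; have [v' Sv' vv'] := vS _ e20.
exists (a *: u' + v'); first exact: Sl.
rewrite opprD addrACA -scalerBr [e]splitr realcD.
rewrite (le_lt_trans (ler_normD _ _))// ler_ltD// normrZ.
move: uu'; rewrite realcM realcV realcD -ge0_realE ?normr_ge0//.
rewrite ltr_pdivlMr ?ltr_wpDl// mulrC => /ltW; apply: le_trans.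
by rewrite ler_wpM2r// lerDl.
Qed.

Lemma dense_eps_closure S : (forall u, eps_closure S u) -> dense S.
Proof.
move=> Sd O [u Ou] Oo.
have /nbhs_ballP [e /= e0 eO] : nbhs u O by exact: open_nbhs_nbhs.
have [|v Sv uv] := Sd u (complex.Re e); first by rewrite -ltcR -gt0_realE.
by exists v; split=> //; apply: eO; rewrite -ball_normE /= (gt0_realE e0).
Qed.

Lemma commutant_cyclic (A : set (H -> H)) (Omega : H) :
  von_neumann_algebra A -> separating_for A Omega ->
  cyclic_for (commutant A) Omega.
Proof.
move=> vA sep; apply: dense_eps_closure; set S := orbit_of _ _.
have Ssub : subspace S.
  split.
    (* The zero operator, written as a combination to which [commutant_comb] applies. *)
    exists (-1 *: id + id); last first.
      by change (-1 *: Omega + Omega = 0); rewrite scaleN1r addNr.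
    apply: commutant_comb; [exact: vna_bounded vA|exact: commutant_id..].
  move=> a _ _ [x xA <-] [y yA <-]; exists (a *: x + y) => //.
  by apply: commutant_comb => //; exact: vna_bounded vA.
have Sinv y u : commutant A y -> S u -> S (y u).
  by move=> yA [x xA <-]; exists (y \o x) => //; exact: commutant_comp.
pose K := eps_closure S.
have Ksub : subspace K by exact: subspace_eps_closure.
have Kcl : eps_closed K by exact: eps_closed_closure.
have Kinv y u : commutant A y -> K u -> K (y u).
  move=> yA; apply: eps_closure_bounded_op yA.1 _ _ => v; exact: Sinv.
have /choice [P PP] u : exists p, K p /\ forall v, K v -> hdot (u - p) v = 0.
  by have [p Kp pK] := orth_projection u Ksub Kcl; exists p.
(* Membership in [K] and an orthogonal residual characterize [P u]; linearity of [P] and its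
   commutation relations are read off from this. *)
have Puniq u p : K p -> (forall v, K v -> hdot (u - p) v = 0) -> P u = p.
  move=> Kp pK; apply/eqP; rewrite -subr_eq0 -(dnorm_eq0 hdot).
  have Kd : K (P u - p).
    by rewrite addrC -scaleN1r; apply: Ksub.2 => //; exact: (PP u).1.
  have dE : P u - p = (u - p) - (u - P u) by rewrite opprB [RHS]addrC subrKA.
  by rewrite {1}dE hdotBl pK // (PP u).2 // subr0.
(* By the bicommutant property [P] need only be bounded and commute with the commutant. Each [y]
   there and its adjoint preserve [K], so [y (P u)] is the projection of [y u]. *)
have PinA : A P.
  rewrite -(vna_bicommutant vA); split.
    apply/bounded_opP; split.
      move=> a u v; apply: Puniq; first by apply: Ksub.2; exact: (PP _).1.
      move=> w Kw; rewrite opprD addrACA -scalerBr hdotDl hdotZl.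
      by rewrite !(PP _).2// mulr0 addr0.
    exists 1 => // u; rewrite mul1r.
    suff: `|P u| ^+ 2 <= `|u| ^+ 2 by rewrite ler_pXn2r ?nnegrE.
    have /pythagoras : hdot (u - P u) (P u) = 0 by apply: (PP u).2; exact: (PP u).1.
    by rewrite subrK => ->; rewrite lerDr exprn_ge0.
  move=> y yA; apply/funext => u; apply/esym/Puniq => /=; first exact: Kinv (PP u).1.
  move=> v Kv; rewrite -linear_sub; last exact: yA.1.1.
  have [y' y'A yy'] := commutant_adjoint (vna_adjoint vA) yA.
  by rewrite yy' (PP u).2//; exact: Kinv.
(* [Omega] lies in [K], so [P - 1] kills it and vanishes because [Omega] is separating; thus [K] is
   all of [H]. *)
suff PE u : P u = u by move=> u; rewrite -[u]PE; exact: (PP u).1.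
have := sep (-1 *: id + P) _ _ => /(_ _ _) /(congr1 (fun h => h u)) E.
apply/eqP; rewrite -subr_eq0 addrC -scaleN1r; apply/eqP; apply: E.
  by apply: vna_add => //; apply: vna_scale => //; exact: vna_id.
change (-1 *: Omega + P Omega = 0); rewrite (Puniq _ Omega) ?scaleN1r ?addNr//.
  by apply: subset_eps_closure; exists id => //; exact: commutant_id.
by move=> v _; rewrite subrr linear0l.
Qed.

End HilbertSpace.

(** * Uniform continuity of the integrand on compact intervals *)

Section OperatorProcesses.
Context {R : realType} {H : hilbertType R}.

(** Compactness of [[0, t]] in its near-covering form turns a radius valid near each point into a
    common one. *)
Lemma opnorm_uniformly_continuous (f : R -> H -> H) (t : R) :
    (forall r, 0 <= r -> bounded_op (f r)) -> opnorm_continuous f ->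
  forall e : R, 0 < e -> exists2 d, 0 < d &
    forall r s, 0 <= r <= t -> 0 <= s <= t -> `|r - s| < d ->
      forall u, `|f r u - f s u| <= e%:C * `|u|.
Proof.
move=> fb fc e e0; have e20 : 0 < e / 2 by rewrite divr_gt0.
have fop r s u : 0 <= r -> 0 <= s ->
    `|f r u - f s u| <= (opnorm (f r - f s))%:C * `|u|.
  move=> r0 s0; apply: le_opnorm.
  by rewrite addrC -scaleN1r; apply: bounded_op_comb; exact: fb.
have /compact_near_coveringP cov := @segment_compact R 0 t.
pose P (d : R) (r : R) := 0 <= r <= t -> forall s, 0 <= s <= t ->
  `|r - s| < d -> forall u, `|f r u - f s u| <= e%:C * `|u|.
have : \forall d \near (0 : R)^'+, `[0, t] `<=` P d.
  apply: cov => x; rewrite /= in_itv /= => /andP[x0 xt].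
  have /cvgr0Pnorm_lt /(_ _ e20) := fc x x0.
  move=> /nbhs_ballP [eta /= eta0 etaP].
  have eta20 : 0 < eta / 2 by rewrite divr_gt0.
  have near_x s : 0 <= s -> `|x - s| < eta ->
      forall u, `|f s u - f x u| <= (e / 2)%:C * `|u|.
    move=> s0 xs u; apply: (le_trans (fop _ _ _ s0 x0)); rewrite ler_wpM2r//.
    rewrite lecR; apply/ltW/(le_lt_trans (ler_norm _)); apply: etaP => //=.
    by rewrite in_itv /= s0.
  (* With both radii halved, [r] and [s] each lie within [eta] of [x], and [f x] is compared with
     both at cost [e / 2]. *)
  exists (ball x (eta / 2), [set d | d < eta / 2]) => /=.
    split; first exact: nbhsx_ballx.
    exact: nbhs_right_lt.
  move=> [r d] /= [xr dl] /andP[r0 rt] s /andP[s0 st] rs u.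
  have -> : f r u - f s u = (f r u - f x u) - (f s u - f x u).
    by rewrite opprB addrA subrK.
  rewrite (le_trans (ler_normB _ _))// [e]splitr realcD mulrDl.
  rewrite lerD// near_x//; first by
    rewrite (lt_le_trans xr)// ler_pdivrMr// ler_peMr ?ler1n// ltW.
  rewrite -[x - s](subrKA r) (le_lt_trans (ler_normD _ _))// [eta]splitr.
  by rewrite ltrD // (lt_trans rs).
move=> [d /= d0 dP]; exists (d / 2); first by rewrite divr_gt0.
have d20 : 0 < d / 2 by rewrite divr_gt0.
move=> r s rt st rs u; apply: (dP (d / 2)) => //=.
by rewrite sub0r normrN gtr0_norm// gtr_pMr// invf_lt1 ?ltr1n.
Qed.

(** * Orthogonality of martingale increments *)

Section MartingaleSums.
Context {Omega : H} {A : set (H -> H)} {At : R -> set (H -> H)}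
  {Et : R -> (H -> H) -> (H -> H)} {X : R -> H -> H}.
Context (vA : von_neumann_algebra A)
  (filt : filtration A (vector_state Omega) At Et) (mart : martingale A Et X).

Let XA s : 0 <= s -> A (X s).
Proof. exact: mart.1. Qed.

Lemma martingale_adapted t : 0 <= t -> At t (X t).
Proof.
move=> t0; rewrite -(mart.2 t t t0 (lexx t)).
exact (ce_range (filt_ce filt t0) (XA t0)).
Qed.

Lemma vna_sub (M : set (H -> H)) x y :
  von_neumann_algebra M -> M x -> M y -> M (x - y).
Proof.
move=> vM Mx My; rewrite addrC -scaleN1r.
by apply: (vna_add vM) => //; exact: (vna_scale vM).
Qed.

(** Moving [g] and [v] across by adjoints gives the state of [y (X b - X a)] with [y] in [At a].
    Invariance and the bimodule property replace the increment by its conditional expectation, which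
    is 0. *)
Lemma martingale_increment_orth a b g v : 0 <= a -> a <= b ->
  At a g -> At a v -> hdot (g ((X b - X a) Omega)) (v Omega) = 0.
Proof.
move=> a0 ab ga va; have vAa := filt_vna filt a0.
have b0 := le_trans a0 ab; have sub := filt_sub filt a0.
have [w wa gw] := vna_adjoint vAa ga.
have [y ya wvy] := vna_adjoint vAa (vna_comp vAa wa va).
rewrite gw -[w _]/((w \o v) Omega) -(is_adjointC wvy).
have AX : A (X b - X a) by exact: vna_sub vA (XA b0) (XA a0).
(* The trailing [id] fits the two-sided form of [ce_bimodule]. *)
have Ay : A (y \o (X b - X a) \o id).
  exact: (vna_comp vA (vna_comp vA (sub _ ya) AX) (vna_id vA)).
have := filt_inv filt a0 Ay; rewrite /vector_state /= => <-.
rewrite (ce_bimodule (filt_ce filt a0)) //; last exact: vna_id.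
have -> : Et a (X b - X a) = 0.
  rewrite addrC -scaleN1r (ce_linear (filt_ce filt a0)); try exact: XA.
  by rewrite !mart.2 // scaleN1r addNr.
have yl := (vna_bounded vAa ya).1.
by rewrite /= [X in y X]/(0 : H) linear_zero // linear0l.
Qed.

(** Pythagoras for [X b = (X b - X a) + X a]; it makes sums of squared increments telescope. *)
Lemma martingale_increment_norm a b : 0 <= a -> a <= b ->
  `|(X b - X a) Omega| ^+ 2 = `|X b Omega| ^+ 2 - `|X a Omega| ^+ 2.
Proof.
move=> a0 ab; have vAa := filt_vna filt a0.
have := martingale_increment_orth a0 ab (vna_id vAa) (martingale_adapted a0).
move=> /pythagoras; rewrite -[(X b - X a) Omega]/(X b Omega - X a Omega) /=.
by rewrite subrK => ->; rewrite addrK.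
Qed.

(** * Comparison of the sums along two partitions *)

Context (f : R -> H -> H) (fad : adapted At f).

(* The Riemann-Stieltjes sum along the path [a :: s], except that the
   integrand of the first increment is frozen at [c] instead of [a]. *)
Fixpoint path_sum (c a : R) (s : seq R) : H :=
  if s is b :: s' then f c ((X b - X a) Omega) + path_sum b b s' else 0.

Lemma path_sum_refine c a b b' s : 0 <= c ->
  path_sum c a (b' :: s) = f c ((X b - X a) Omega) + path_sum c b (b' :: s).
Proof.
move=> c0 /=; rewrite addrA; congr (_ + _).
have fl := (vna_bounded (filt_vna filt c0) (fad c0)).1.
rewrite -linear_add//; congr (f c).
change (X b' Omega - X a Omega = X b Omega - X a Omega + (X b' Omega - X b Omega)).
by rewrite addrC [RHS]addrC addrA subrK addrC.
Qed.

(** Order and mesh bound in one relation, so that a fine partition is a single [path]. *)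
Definition mesh_rel (d : R) : rel R := fun r s => (r < s) && (s - r < d).

(* [q] behaves like a sum over [a, t] of orthogonal martingale increments whose
   coefficients have norm at most [e]. *)
Definition dominated (e a t : R) (q : H) : Prop :=
  (forall v, At a v -> hdot q (v Omega) = 0) /\
  `|q| ^+ 2 <= e%:C ^+ 2 * (`|X t Omega| ^+ 2 - `|X a Omega| ^+ 2).

Context (t d e : R) (e0 : 0 < e).
Context (funif : forall r s, 0 <= r <= t -> 0 <= s <= t -> `|r - s| < d ->
  forall u, `|f r u - f s u| <= e%:C * `|u|).

(** The new term has its coefficient [f c - f c'] in [At a], so it is orthogonal to the orbit of
    [Omega] under [At a]. It lies itself in the orbit under [At b], to which [q] is orthogonal, so
    Pythagoras adds the squared norms. *)
Lemma dominated_step c c' a b q : 0 <= c <= a -> 0 <= c' <= a -> a <= b -> b <= t ->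
  `|c - c'| < d ->
  dominated e b t q ->
  dominated e a t (f c ((X b - X a) Omega) - f c' ((X b - X a) Omega) + q).
Proof.
move=> /andP[c0 ca] /andP[c'0 c'a] ab bt cc' [qo qn].
have a0 := le_trans c0 ca; have b0 := le_trans a0 ab.
have vAa := filt_vna filt a0; have vAb := filt_vna filt b0.
have fca : At a (f c) by apply: (filt_mono filt c0 ca); exact: fad.
have fc'a : At a (f c') by apply: (filt_mono filt c'0 c'a); exact: fad.
have fa : At a (f c - f c') by exact: vna_sub.
set dX := (X b - X a).
rewrite -[f c _ - f c' _]/((f c - f c') (dX Omega)).
have aAb := filt_mono filt a0 ab.
split.
  move=> v va; rewrite hdotDl (martingale_increment_orth a0 ab fa va) add0r.
  by apply: qo; exact: aAb.
have orth : hdot ((f c - f c') (dX Omega)) q = 0.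
  rewrite hdotC (qo ((f c - f c') \o dX)) ?conjC0//.
  apply: (vna_comp vAb); first exact: aAb.
  by apply: vna_sub => //; [|apply: aAb]; exact: martingale_adapted.
rewrite pythagoras//.
have -> : `|X t Omega| ^+ 2 - `|X a Omega| ^+ 2 =
    `|dX Omega| ^+ 2 + (`|X t Omega| ^+ 2 - `|X b Omega| ^+ 2).
  by rewrite martingale_increment_norm// [RHS]addrC subrKA.
rewrite mulrDr lerD// -exprMn ler_pXn2r ?nnegrE ?mulr_ge0 ?ler0c ?(ltW e0)//.
apply: funif => //; rewrite ?c0 ?c'0 (le_trans _ bt)// (le_trans _ ab)//.
Qed.

(* Induction on the merge of the two partitions: [a] is the current point of the
   common refinement, [c] and [c'] the last points of each partition before it. *)
Lemma path_sum_compare n s s' c c' a :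
  (size s + size s' <= n)%N -> 0 <= c <= a -> 0 <= c' <= a ->
  path (mesh_rel d) c s -> path (mesh_rel d) c' s' ->
  path <%R a s -> path <%R a s' -> last a s = t -> last a s' = t ->
  dominated e a t (path_sum c a s - path_sum c' a s').
Proof.
have path_le b r : path <%R b r -> b <= last b r.
  elim: r b => //= b' r IH b /andP[bb' /IH]; exact/le_trans/ltW.
(* Both frozen points lie in the interval from [b - d] to [b], where [b] is the next point of the
   refinement. *)
have close b c1 c2 : 0 <= c1 < b -> 0 <= c2 < b -> b - c1 < d -> b - c2 < d ->
    `|c1 - c2| < d.
  by move=> /andP[_ +] /andP[_ +] + +; rewrite ltr_norml; lra.
elim: n s s' c c' a => [|n IH] s s' c c' a.
  rewrite leqn0 addn_eq0 => /andP[/nilP -> /nilP ->] _ _ _ _ _ _ /= at_ _.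
  by split => [v _|]; rewrite subrr ?linear0l// normr0 expr0n /= at_ subrr mulr0.
case: s s' => [|b s] [|b' s'].
- by move=> _; apply: (IH [::] [::]).
(* An exhausted path means [a = t], and the other path cannot go beyond [t]. *)
- move=> _ _ _ _ _ _ /= /andP[ab' /path_le b'l] at_ l; exfalso.
  by move: b'l; rewrite l -at_ leNgt ab'.
- move=> _ _ _ _ _ /= /andP[ab /path_le bl] _ l at_; exfalso.
  by move: bl; rewrite l -at_ leNgt ab.
move=> sz ca c'a' ps ps' pa pa' la la'.
move: (ca) (c'a') => /andP[c0 ca1] /andP[c'0 c'a1].
case/andP: (ps) => /andP[cb bcd] psb; case/andP: (ps') => /andP[c'b' b'c'd] psb'.
case/andP: (pa) => ab pab; case/andP: (pa') => ab' pab'.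
have bt : b <= t by rewrite -la; exact: path_le pab.
have b't : b' <= t by rewrite -la'; exact: path_le pab'.
have b0 : 0 <= b by rewrite (le_trans c0)// ltW.
have b'0 : 0 <= b' by rewrite (le_trans c'0)// ltW.
have [bb'|b'b|bb'] := ltgtP b b'.
(* The nearer point [b] is inserted into the second path, which stays frozen at [c']. *)
- rewrite (path_sum_refine a b b') // [path_sum c a _]/= opprD addrACA.
  apply: (dominated_step ca c'a' (ltW ab) bt).
    by apply: (close b); rewrite ?c0 ?c'0 //=; lra.
  apply: (IH s (b' :: s')) => //; rewrite ?b0 ?c'0 ?lexx ?(le_trans c'a1 (ltW ab)) //.
  by rewrite /= bb'.
- rewrite (path_sum_refine a b' b) // [path_sum c' a _]/= opprD addrACA.
  apply: (dominated_step ca c'a' (ltW ab') b't).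
    by apply: (close b'); rewrite ?c0 ?c'0 //=; lra.
  apply: (IH (b :: s) s') => //; rewrite ?b'0 ?c0 ?lexx ?(le_trans ca1 (ltW ab')) //.
    by move: sz; rewrite /= addnS.
  by rewrite /= b'b.
- move: la' psb' pab' b'c'd; rewrite -bb' => la' psb' pab' b'c'd /=.
  rewrite opprD addrACA; apply: (dominated_step ca c'a' (ltW ab) bt).
    by apply: (close b); rewrite ?c0 ?c'0 //=; lra.
  apply: IH => //; rewrite ?b0 ?lexx //.
  by move: sz; rewrite /= addnS => /ltnW.
Qed.

End MartingaleSums.

(** * Partitions of small mesh *)

Section Meshes.
Context (t d : R).

(** The hypothesis [0 < d] accounts for the initial value 0 of the maximum in [mesh]. *)
Lemma mesh_ltP s : 0 < d ->
  (itv_partition 0 t s /\ mesh t s < d) <->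
  (path (mesh_rel d) 0 s /\ last 0 s = t).
Proof.
move=> d0; rewrite /itv_partition /mesh big_mkord; split.
  move=> [[ps /eqP ls] /bigmax_ltP [_ md]]; split=> //.
  apply/(pathP t) => i si; rewrite /mesh_rel (pathP t ps)//=.
  exact: (md (Ordinal si)).
move=> [ps ls]; split.
  by split; [apply: sub_path ps => r r' /andP[]|exact/eqP].
apply/bigmax_ltP; split=> // i _.
by have /(pathP t) /(_ i (ltn_ord i)) /andP[] := ps.
Qed.

(** Steps of length [d / 2] are taken until the remaining gap is below [d], which one last step
    closes; the Archimedean property bounds their number. *)
Lemma fine_partition_exists : 0 < d -> 0 < t ->
  exists s, itv_partition 0 t s /\ mesh t s < d.
Proof.
move=> d0 t0; suff fine n a : a < t -> t - a < n.+1%:R * (d / 2) ->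
    exists s, path (mesh_rel d) a s /\ last a s = t.
  have [|s /(mesh_ltP s d0) ?] := fine (Num.truncn (t / (d / 2))) 0 t0.
    by rewrite subr0 -ltr_pdivrMr ?divr_gt0 ?truncnS_gt.
  by exists s.
elim: n a => [|n IH] a at0 tan.
  by exists [:: t]; rewrite /= /mesh_rel at0 andbT; split => //; lra.
have [tad|tad] := ltP (t - a) d.
  by exists [:: t]; rewrite /= /mesh_rel at0 andbT.
have [||s [ps ls]] := IH (a + d / 2); first by lra.
  by move: tan; rewrite -[n.+2]addn1 natrD; lra.
exists (a + d / 2 :: s); split => //=; rewrite ps andbT /mesh_rel.
by apply/andP; split; lra.
Qed.

End Meshes.

(** Partitions finer than any given mesh exist, so the limit condition is never vacuous. *)
Lemma mesh_limit_unique (t : R) (S : seq R -> H) l l' : 0 < t ->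
  mesh_limit t S l -> mesh_limit t S l' -> l = l'.
Proof.
move=> t0 Sl Sl'; apply/eqP; rewrite -subr_eq0 -normr_eq0; apply/eqP.
apply: (@le_eps_eq0 _ _ 2) => // e e0.
have [d d0 dl] := Sl e e0; have [d' d'0 dl'] := Sl' e e0.
have [|s [ps]] := @fine_partition_exists t (Num.min d d') _ t0.
  by rewrite lt_min d0.
rewrite lt_min => /andP[sd sd'].
rewrite -[l - l'](subrKA (S s)) (le_trans (ler_normD _ _))//.
by rewrite mulr_natl mulr2n lerD// ltW//; [rewrite distrC; exact: dl|exact: dl'].
Qed.

(** * Riemann-Stieltjes sums: commutation and convergence at [Omega] *)

Lemma RS_sumE (f X : R -> H -> H) t s u :
  RS_sum f X t s u = \sum_(0 <= k < size s)
    f (nth t (0 :: s) k) (X (nth t s k) u - X (nth t (0 :: s) k) u).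
Proof. by rewrite /RS_sum fct_sumE. Qed.

Lemma RS_sum_path_sum (f X : R -> H -> H) t s u :
  RS_sum f X t s u = path_sum (Omega := u) (X := X) f 0 0 s.
Proof.
rewrite RS_sumE; move: (0 : R); elim: s => [|b s IH] a /=; first by rewrite big_geq.
by rewrite big_nat_recl //= -IH.
Qed.

Lemma RS_sum_commutant (A : set (H -> H)) (f X : R -> H -> H) t s x u :
  process A f -> process A X -> commutant A x -> itv_partition 0 t s ->
  RS_sum f X t s (x u) = x (RS_sum f X t s u).
Proof.
move=> fA XA xA ps; have xl := xA.1.1.
rewrite !RS_sumE.
rewrite (big_morph x (fun v w => linear_add v w xl) (linear_zero xl)).
apply: eq_big_nat => k /andP[_ ks].
(* Past the end [nth] returns its default [t], also nonnegative, so [XE] needs no bound on the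
   index. *)
have ge0 j : 0 <= nth t (0 :: s) j.
  have [js|sj] := ltnP j (size s).+1; first exact: itv_partition_nth_ge.
  by rewrite nth_default//; exact: itv_partition_le ps.
have XE j : X (nth t (0 :: s) j) (x u) = x (X (nth t (0 :: s) j) u).
  by rewrite (commutantE _ xA) //; exact: XA.
rewrite -[nth t s k]/(nth t (0 :: s) k.+1) !XE -linear_sub//.
by rewrite (commutantE _ xA (fA _ (ge0 k))).
Qed.

Lemma martingale_RS_limit (Omega : H) (A : set (H -> H))
    (At : R -> set (H -> H)) (Et : R -> (H -> H) -> (H -> H))
    (X f : R -> H -> H) (t : R) :
  von_neumann_algebra A -> filtration A (vector_state Omega) At Et ->
  martingale A Et X -> opnorm_continuous f -> adapted At f -> 0 < t ->
  exists l, mesh_limit t (fun s => RS_sum f X t s Omega) l.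
Proof.
move=> vA filt mart fc fad t0.
have fb r : 0 <= r -> bounded_op (f r).
  by move=> r0; apply: (vna_bounded (filt_vna filt r0)); exact: fad.
pose B d := [set s | itv_partition 0 t s /\ mesh t s < d].
have Bmono d e : d <= e -> B d `<=` B e.
  by move=> de s [ps sd]; split => //; exact: lt_le_trans de.
have B0 d : 0 < d -> B d !=set0.
  by move=> d0; have [s Bs] := fine_partition_exists d0 t0; exists s.
pose N := complex.Re `|X t Omega|.
have NE : `|X t Omega| = N%:C by rewrite -ge0_realE ?normr_ge0.
have N0 : 0 <= N by rewrite -ler0c -NE.
have [e e0|l lP] := @cauchy_basis_cvg _ _ _ B (fun s => RS_sum f X t s Omega) B0 Bmono.
  (* With this coefficient bound the difference of two sums has norm at most
     [e * N / (N + 1) < e]. *)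
  have e'0 : 0 < e / (N + 1) by rewrite divr_gt0// ltr_wpDl.
  have [d d0 funif] := opnorm_uniformly_continuous t fb fc e'0.
  exists d => // s s' Bs Bs'; rewrite !RS_sum_path_sum.
  have [ps ls] := (mesh_ltP t s d0).1 Bs; have [ps' ls'] := (mesh_ltP t s' d0).1 Bs'.
  have lt_path r : path (mesh_rel d) 0 r -> path <%R 0 r.
    by move=> pr; apply: sub_path pr => ? ? /andP[].
  have z0 : 0 <= (0 : R) <= 0 by rewrite lexx.
  have [_] := path_sum_compare vA filt mart fad e'0 funif (leqnn _) z0 z0
    ps ps' (lt_path _ ps) (lt_path _ ps') ls ls'.
  set D := _ - _ => DN.
  have D2 : `|D| ^+ 2 <= ((e / (N + 1))%:C * N%:C) ^+ 2.
    rewrite (le_trans DN)// exprMn -NE ler_wpM2l ?exprn_ge0 ?ler0c ?(ltW e'0)//.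
    by rewrite gerBl exprn_ge0.
  rewrite ler_pXn2r ?nnegrE ?mulr_ge0 ?ler0c ?(ltW e'0)// in D2.
  apply: (le_lt_trans D2); rewrite -realcM ltcR mulrAC ltr_pdivrMr ?ltr_wpDl//.
  by rewrite ltr_pM2l// ltrDl.
exists l => e /lP [d d0 dl]; exists d => // s ps sd; exact: dl.
Qed.

End OperatorProcesses.

(** * The integral as an operator on the orbit of [Omega] under the commutant *)

Theorem theorem2 (R : realType) (H : hilbertType R)
    (A : set (H -> H)) (Omega : H)
    (At : R -> set (H -> H)) (Et : R -> (H -> H) -> (H -> H))
    (X f : R -> H -> H) :
  von_neumann_algebra A ->
  `|Omega| = 1 -> cyclic_for A Omega -> separating_for A Omega ->
  filtration A (vector_state Omega) At Et ->
  martingale A Et X ->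
  process A f -> opnorm_continuous f -> adapted At f ->
  forall t : R, 0 < t ->
  exists T : operator H,
    [/\ op_dom T = orbit_of (commutant A) Omega,
        densely_defined T,
        affiliated A T &
        forall x', commutant A x' ->
          mesh_limit t (fun s => RS_sum f X t s (x' Omega)) (T (x' Omega))].
Proof.
move=> vA _ _ sep filt mart fA fc fad t t0.
have [eta etaP] := martingale_RS_limit vA filt mart fc fad t0.
have limP x : commutant A x ->
    mesh_limit t (fun s => RS_sum f X t s (x Omega)) (x eta).
  move=> xA e e0; have /bounded_opP [xl [C C0 xC]] := xA.1.
  (* Dividing by [C + 1] rather than [C] covers the case [C = 0]. *)
  have C1 : 0 < C + 1 by rewrite ltr_wpDl.
  have [d d0 dP] := etaP _ (divr_gt0 e0 C1); exists d => // s ps sd.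
  rewrite (RS_sum_commutant _ fA mart.1 xA ps) -linear_sub//.
  apply: (@le_lt_trans _ _ ((C + 1)%:C * `|RS_sum f X t s Omega - eta|)).
    by rewrite (le_trans (xC _))// ler_wpM2r// lecR lerDl.
  by rewrite mulrC -ltr_pdivlMr ?ltcR// -realcV -realcM dP.
(* Defining [T u] by the limit at the vector [u] makes it independent of the [x] with [u = x Omega];
   0 is the value where no limit exists. *)
pose T u := xget 0 [set l | mesh_limit t (fun s => RS_sum f X t s u) l].
have TE x : commutant A x -> T (x Omega) = x eta.
  move=> xA; apply: (mesh_limit_unique t0) (limP _ xA).
  by apply: (@xgetPex _ _ [set l | mesh_limit t _ l]); exists (x eta); exact: limP.
have comb a x y : commutant A x -> commutant A y -> commutant A (a *: x + y).
  exact: commutant_comb (vna_bounded vA).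
have dom0 : orbit_of (commutant A) Omega 0.
  exists (-1 *: id + id); first by apply: comb; exact: commutant_id.
  by change (-1 *: Omega + Omega = 0); rewrite scaleN1r addNr.
have dom_lin a u v : orbit_of (commutant A) Omega u ->
    orbit_of (commutant A) Omega v -> orbit_of (commutant A) Omega (a *: u + v).
  by move=> [x xA <-] [y yA <-]; exists (a *: x + y) => //; exact: comb.
have T_lin a u v : orbit_of (commutant A) Omega u ->
    orbit_of (commutant A) Omega v -> T (a *: u + v) = a *: T u + T v.
  move=> [x xA <-] [y yA <-]; rewrite !TE//.
  exact: (TE _ (comb a x y xA yA)).
exists (Operator dom0 dom_lin T_lin); split => //=.
- exact: commutant_cyclic.
(* Affiliation is associativity: both sides equal [y (x eta)]. *)
- move=> y _ yA [x xA <-]; have yxA := commutant_comp yA xA.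
  split; first by exists (y \o x).
  by rewrite /= TE// -[y (x Omega)]/((y \o x) Omega) TE.
- by move=> x xA; rewrite TE//; exact: limP.
Qed.
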